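(* Let $n \ge 2$ be an integer and let $X_1, \dots, X_n$ be independent random variables, each uniformly distributed on $[0,1]$. Then the probability that both $X_1 \le X_2 \le \dots \le X_n$ holds and, for every $1 \le i \le n+1$, the length of $I_i$ is strictly less than the sum of the lengths of all $I_j$ with $j \ne i$ (where $I_1, \dots, I_{n+1}$ are the intervals into which $X_1 \le \dots \le X_n$ partition $[0,1]$) is equal to $$\frac{2^n - (n+1)}{2^n \, n!}.$$
   Context: When $X_1 \le \dots \le X_n$, the intervals are $I_1 = [0, X_1]$, $I_i = [X_{i-1}, X_i]$ for $1 < i \le n$, and $I_{n+1} = [X_n, 1]$. The length of an interval $[a,b]$ is $b-a$. The probability is the joint probability of the ordering event and the length condition, not a probability conditional on the ordering. *)

(* Defs.v *)
From HB Require Import structures.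
From mathcomp Require Export all_boot all_order all_algebra.
From mathcomp Require Export all_classical all_reals all_analysis.

Set Implicit Arguments.
Unset Strict Implicit.
Unset Printing Implicit Defensive.

Import Order.TTheory GRing.Theory Num.Theory.
Import numFieldNormedType.Exports.

Local Open Scope classical_set_scope.
Local Open Scope ring_scope.

Definition mutually_independent (d d' : measure_display) (T : measurableType d)
    (T' : measurableType d') (R : realType) (P : probability T R)
    (I : finType) (X : I -> {RV P >-> T'}) : Prop :=
  forall (J : {set I}) (A : I -> set T'), (forall i, measurable (A i)) ->
    P (\bigcap_(i in [set` J]) X i @^-1` A i) =
    (\prod_(i in J) P (X i @^-1` A i))%E.

(* The equality of laws is required on Borel sets only: both sides are total
   functions on [set R], with no meaning on nonmeasurable sets. *)
Definition uniformly_distributed01 (d : measure_display) (T : measurableType d)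
    (R : realType) (P : probability T R) (X : {RV P >-> R}) : Prop :=
  forall A : set R, measurable A ->
    distribution P X A = uniform_prob (@ltr01 R) A.

(* For [k] from 0 to n + 1: the values 0, x_1, ..., x_n, 1, where x_k is
   [x] at the ordinal k - 1. *)
Definition division_point (R : realType) (n : nat) (x : 'I_n -> R) (k : nat) : R :=
  if k is j.+1 then (if insub j is Some i then x i else 1) else 0.

(* The ordinal [i] stands for the interval I_(i+1). *)
Definition division_itv (R : realType) (n : nat) (x : 'I_n -> R)
    (i : 'I_n.+1) : interval R :=
  `[division_point x i, division_point x i.+1]%R.

(* Unbounded intervals get the junk value 0. *)
Definition itv_length (R : realType) (I : interval R) : R :=
  if I is Interval (BSide _ a) (BSide _ b) then b - a else 0.

(* Main.v *)
Require Import Defs.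
From mathcomp Require Import measurable_realfun ring lra.

Set Implicit Arguments.
Unset Strict Implicit.
Unset Printing Implicit Defensive.

Import Order.TTheory GRing.Theory Num.Theory.
Import numFieldNormedType.Exports.

Local Open Scope classical_set_scope.
Local Open Scope ring_scope.

(* The lengths add up to 1, so the condition says that every gap is shorter than
   1/2. For prescribed c_0, ..., c_n >= 0 of sum s, the probability that the
   points are sorted with i-th gap at least c_i is (1 - s)_+^n / n!. With c = 0
   this gives 1/n! for the sorted points; with c equal to 1/2 at one index it
   gives 2^-n / n! for each of the n + 1 ways in which some gap is too long; with
   c equal to 1/2 at two indices it shows that two gaps are too long only with
   probability 0. Hence the answer is 1/n! - (n + 1) 2^-n / n!. *)

(** * Truncated powers as successive primitives *)

(** A Riemann sum argument. On each of [N.+1] equal pieces of length [h], both increments lie in the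
    same enclosure, so they differ by at most [h] times the increment of [f] there. These bounds
    telescope to [(f b - f a) * h = K / N.+1], which is arbitrarily small. *)
Lemma primitive_increment_unique (R : realType) (f F G : R -> R) (a b : R) :
  a <= b ->
  (forall x y, a <= x -> x <= y -> y <= b ->
     f x * (y - x) <= F y - F x <= f y * (y - x)) ->
  (forall x y, a <= x -> x <= y -> y <= b ->
     f x * (y - x) <= G y - G x <= f y * (y - x)) ->
  F b - F a = G b - G a.
Proof.
move=> ab hF hG; set K := (f b - f a) * (b - a).
have bound N : `|(F b - F a) - (G b - G a)| * N.+1%:R <= K.
  pose h := (b - a) / N.+1%:R; pose x m := a + m%:R * h.
  have N0 : 0 < N.+1%:R :> R by rewrite ltr0n.
  have h0 : 0 <= h by rewrite divr_ge0 ?subr_ge0 // ltW.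
  have hN : N.+1%:R * h = b - a by rewrite /h mulrC divfK ?gt_eqF.
  have xS m : x m.+1 - x m = h by rewrite /x -natr1; ring.
  have step m : (m <= N.+1)%N ->
      `|(F (x m) - F a) - (G (x m) - G a)| <= (f (x m) - f a) * h.
    elim: m => [_|m IH mN].
      by rewrite {1 2 3}/x mul0r addr0 !subrr normr0 mul0r.
    have axm : a <= x m by rewrite /x lerDl mulr_ge0.
    have xmS : x m <= x m.+1 by rewrite -subr_ge0 xS.
    have xmb : x m.+1 <= b.
      rewrite /x -lerBrDl -hN ler_wpM2r // ler_nat.
      exact: mN.
    have /andP[F1 F2] := hF _ _ axm xmS xmb.
    have /andP[G1 G2] := hG _ _ axm xmS xmb.
    have := IH (ltnW mN); rewrite xS in F1 F2 G1 G2.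
    rewrite !ler_norml !mulrBl => /andP[? ?].
    apply/andP; split; lra.
  have := step _ (leqnn _); rewrite (_ : x N.+1 = b); last by rewrite /x hN; ring.
  move=> H; rewrite -ler_pdivlMr //; apply: le_trans H _.
  by rewrite /h mulrA.
apply/eqP; rewrite -subr_eq0 -normr_eq0; apply: contraT => D0.
have {}D0 : 0 < `|(F b - F a) - (G b - G a)| by rewrite lt_def D0 normr_ge0.
(* By the Archimedean property this index is too large for [bound] once the difference is
   positive. *)
have := bound (Num.bound (K / `|(F b - F a) - (G b - G a)|)).
rewrite -ler_pdivlMl // leNgt mulrC => /negP[].
have K0 : 0 <= K by apply: le_trans (bound 0); rewrite mulr1.
apply: lt_le_trans (archi_boundP (divr_ge0 K0 (ltW D0))) _.
by rewrite ler_nat.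
Qed.

(* The convention at [k = 0] is the indicator of [s <= x], not the constant 1. *)
Definition truncated_power (R : realType) (k : nat) (s x : R) : R :=
  if s <= x then (x - s) ^+ k / k`!%:R else 0.

(** A positive exponent makes the two branches agree at [x = s]; with exponent 0 there is a jump
    from 0 to 1. *)
Lemma truncated_powerS0 (R : realType) (k : nat) (s x : R) :
  x <= s -> truncated_power k.+1 s x = 0.
Proof.
rewrite /truncated_power => xs; case: ifP => // sx.
have -> : x = s by apply/eqP; rewrite eq_le xs sx.
by rewrite subrr expr0n mul0r.
Qed.

(** Factor out [v - u]: the cofactor has [k.+1] terms, each between [u ^+ k] and [v ^+ k]. *)
Lemma expr_increment (R : realFieldType) (k : nat) (u v : R) :
  0 <= u -> u <= v ->
  k.+1%:R * u ^+ k * (v - u) <= v ^+ k.+1 - u ^+ k.+1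
    <= k.+1%:R * v ^+ k * (v - u).
Proof.
move=> u0 uv; have v0 := le_trans u0 uv; have vu : 0 <= v - u by rewrite subr_ge0.
rewrite subrXX [(v - u) * _]mulrC !ler_wpM2r //=.
- have -> : k.+1%:R * v ^+ k = \sum_(i < k.+1) v ^+ k.
    by rewrite sumr_const card_ord mulr_natl.
  apply: ler_sum => i _; have ik : (i <= k)%N by rewrite -ltnS.
  rewrite -[X in _ <= v ^+ X](subnK ik) exprD.
  by rewrite ler_wpM2l ?exprn_ge0 // lerXn2r.
- have -> : k.+1%:R * u ^+ k = \sum_(i < k.+1) u ^+ k.
    by rewrite sumr_const card_ord mulr_natl.
  apply: ler_sum => i _; have ik : (i <= k)%N by rewrite -ltnS.
  rewrite -[X in u ^+ X <= _](subnK ik) exprD.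
  by rewrite ler_wpM2r ?exprn_ge0 // lerXn2r.
Qed.

(** This is the enclosure that [primitive_increment_unique] asks for: it makes each truncated power
    a primitive of the preceding one. *)
Lemma truncated_power_increment (R : realType) (k : nat) (s x y : R) : x <= y ->
  truncated_power k s x * (y - x)
    <= truncated_power k.+1 s y - truncated_power k.+1 s x
    <= truncated_power k s y * (y - x).
Proof.
move=> xy.
have inc u v : s <= u -> u <= v ->
    truncated_power k s u * (v - u)
      <= truncated_power k.+1 s v - truncated_power k.+1 s u
      <= truncated_power k s v * (v - u).
  move=> su uv; rewrite /truncated_power su (le_trans su uv).
  have k0 : 0 < k.+1%:R :> R by rewrite ltr0n.
  have f0 : 0 < k`!%:R :> R by rewrite ltr0n fact_gt0.
  have := @expr_increment R k (u - s) (v - s).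
  rewrite subr_ge0 lerD2r (_ : v - s - (u - s) = v - u); last by ring.
  move=> /(_ su uv) /andP[H1 H2].
  rewrite -mulrBl factS natrM.
  rewrite ler_pdivlMr ?ler_pdivrMr ?mulr_gt0 //.
  have cancel_fact z : z ^+ k / k`!%:R * (v - u) * (k.+1%:R * k`!%:R)
      = k.+1%:R * z ^+ k * (v - u).
    by field; rewrite gt_eqF.
  by rewrite !cancel_fact H1 H2.
case: (leP s x) => [sx|xs]; first exact: inc.
rewrite {1}/truncated_power (lt_geF xs) mul0r.
rewrite [truncated_power k.+1 s x]truncated_powerS0 ?subr0; last exact: ltW.
case: (leP s y) => [sy|ys]; last first.
  by rewrite /truncated_power (lt_geF ys) mul0r lexx.
(* When [x < s <= y], the growth happens on [[s, y]] only, and [y - s <= y - x]. *)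
have /andP[_] := inc _ _ (lexx s) sy.
rewrite [truncated_power k.+1 s s]truncated_powerS0 // subr0 => H.
have G0 m : 0 <= truncated_power m s y.
  by rewrite /truncated_power sy divr_ge0 ?exprn_ge0 ?subr_ge0.
rewrite G0 (le_trans H) // ler_wpM2l // lerB // ltW //.
Qed.

(** * The uniform law and elementary measure facts *)

Lemma uniform_prob01E (R : realType) (A : set R) : measurable A ->
  uniform_prob (@ltr01 R) A = lebesgue_measure (A `&` `[0, 1]).
Proof.
move=> mA; rewrite /uniform_prob integral_uniform_pdf.
transitivity (\int[lebesgue_measure]_(x in A `&` `[0%R, 1%R]) (1:R)%:E)%E.
  apply: eq_integral => x; rewrite inE => -[_] /=; rewrite in_itv /= => xab.
  by rewrite /uniform_pdf xab subr0 invr1.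
by rewrite integral_cst ?mul1e //; exact: measurableI.
Qed.

Lemma measurable_set_ler (d : measure_display) (T : measurableType d)
    (R : realType) (f g : T -> R) :
  measurable_fun setT f -> measurable_fun setT g ->
  measurable [set w | f w <= g w].
Proof.
by move=> mf mg; have := measurable_fun_le measurableT mf mg; rewrite setTI.
Qed.

Lemma measurable_set_forall (d : measure_display) (T : measurableType d)
    (I : finType) (Q : I -> set T) :
  (forall i, measurable (Q i)) -> measurable [set w | forall i, Q i w].
Proof.
move=> mQ; rewrite (_ : [set w | _] = \bigcap_(i in [set: I]) Q i).
  by apply: fin_bigcap_measurable => // i _; exact: mQ.
by apply/seteqP; split=> w /= h // i; exact: h.
Qed.

Lemma fine_measure_le (d : measure_display) (T : measurableType d)
    (R : realType) (P : probability T R) (A B : set T) :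
  measurable A -> measurable B -> A `<=` B -> fine (P A) <= fine (P B).
Proof.
move=> mA mB AB; apply: fine_le; rewrite ?fin_num_measure //.
by rewrite le_measure ?inE.
Qed.

Lemma fine_measureD (d : measure_display) (T : measurableType d)
    (R : realType) (P : probability T R) (A B : set T) :
  measurable A -> measurable B -> B `<=` A ->
  fine (P (A `\` B)) = fine (P A) - fine (P B).
Proof.
move=> mA mB BA; rewrite measureD ?ltey_eq ?fin_num_measure //.
by rewrite setIidr // fineB ?fin_num_measure.
Qed.

Lemma measurable_division_point (R : realType) (d : measure_display)
    (T : measurableType d) (n : nat) (X : 'I_n -> T -> R) (k : nat) :
  (forall i, measurable_fun setT (X i)) ->
  measurable_fun setT (fun w => division_point (fun i => X i w) k).
Proof.
move=> mX; case: k => [|k] /=; first exact: measurable_cst.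
by case: insubP => [i _ _|_]; [exact: mX | exact: measurable_cst].
Qed.

(** * Probability of prescribed minimal gaps *)

Section Spacings.
Context (R : realType) (d : measure_display) (T : measurableType d).
Context (P : probability T R) (n : nat) (X : 'I_n -> {RV P >-> R}).

(** The bound [t] stands in for the point of index [k.+1], so [k.+1] gaps are bounded below. Keeping
    [t] free allows an induction on [k]; [k = n] and [t = 1] give the event about all gaps. *)
Definition spaced (c : nat -> R) (k : nat) (t : R) : set T :=
  [set w | (forall j : 'I_k, division_point (X ^~ w) j + c j
                             <= division_point (X ^~ w) j.+1) /\
           division_point (X ^~ w) k + c k <= t].

Definition box (A : 'I_n -> set R) : set T := \bigcap_i (X i @^-1` A i).

Lemma measurable_spaced c k t : measurable (spaced c k t).
Proof.
have mD j : measurable_fun setT (fun w => division_point (X ^~ w) j).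
  by apply: measurable_division_point => i; exact: measurable_funPT.
apply: measurableI.
  apply: measurable_set_forall => j; apply: measurable_set_ler => //.
  by apply: measurable_funD => //; exact: measurable_cst.
apply: measurable_set_ler; last exact: measurable_cst.
by apply: measurable_funD => //; exact: measurable_cst.
Qed.

Lemma measurable_box A : (forall i, measurable (A i)) -> measurable (box A).
Proof.
move=> mA; apply: fin_bigcap_measurable => // i _.
rewrite -[X in measurable X]setTI; exact: measurable_funPT.
Qed.

(** The recursion behind the induction on [k]: the value of the next variable becomes the endpoint
    of the previous level. *)
Lemma spacedS c k t w (kn : (k < n)%N) :
  spaced c k.+1 t w <->
  spaced c k (X (Ordinal kn) w) w /\ X (Ordinal kn) w + c k.+1 <= t.
Proof.
have DE : division_point (X ^~ w) k.+1 = X (Ordinal kn) w.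
  by rewrite /division_point insubT.
rewrite /spaced -DE; split.
  move=> [h1 h2]; split=> //; split; last exact: (h1 ord_max).
  by move=> j; exact: (h1 (widen_ord (leqnSn k) j)).
move=> [[h1 h2] h3]; split=> // j.
by case: (unliftP ord_max j) => [i|] -> //; rewrite lift_max; exact: h1.
Qed.

Context (indepX : mutually_independent X).
Context (unifX : forall i : 'I_n, uniformly_distributed01 (X i)).

Lemma prob_box A : (forall i, measurable (A i)) ->
  P (box A) = (\prod_i P (X i @^-1` A i))%E.
Proof.
move=> mA; have := @indepX [set: 'I_n]%SET A mA.
rewrite (_ : [set` _] = setT); last by apply/seteqP; split=> i //= _; rewrite inE.
by move=> ->; apply: eq_bigl => i; rewrite inE.
Qed.

Lemma prob_preimage i A : measurable A ->
  P (X i @^-1` A) = lebesgue_measure (A `&` `[0, 1]).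
Proof. by move=> mA; rewrite -uniform_prob01E // -(unifX i mA). Qed.

Lemma prob_itvoc i (x y : R) : 0 <= x -> x <= y -> y <= 1 ->
  P (X i @^-1` `]x, y]) = (y - x)%:E.
Proof.
move=> x0 xy y1; rewrite prob_preimage // setIidl; last first.
  move=> z /=; rewrite !in_itv /= => /andP[xz zy].
  by rewrite (le_trans x0 (ltW xz)) (le_trans zy y1).
rewrite lebesgue_measure_itv /= lte_fin; case: ltgtP xy => // -> _.
by rewrite subrr.
Qed.

(** Gives the starting value 0 of the primitive in [prob_spaced_box], and later discards outcomes
    whose first point is not positive. *)
Lemma prob_nonpos i : P [set w | X i w <= 0] = 0%E.
Proof.
rewrite (_ : [set w | _] = X i @^-1` `]-oo, 0]); last first.
  by apply/seteqP; split=> w; rewrite /= in_itv.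
rewrite prob_preimage // (_ : _ `&` _ = [set 0]) ?lebesgue_measure_set1 //.
apply/seteqP; split=> z /=; rewrite !in_itv /=; last by move=> ->; rewrite lexx ler01.
by move=> [z0 /andP[z1 _]]; apply/eqP; rewrite eq_le z0.
Qed.

Lemma prob_gt1 i : P [set w | 1 < X i w] = 0%E.
Proof.
rewrite (_ : [set w | _] = X i @^-1` `]1, +oo[); last first.
  by apply/seteqP; split=> w; rewrite /= in_itv /= andbT.
rewrite prob_preimage // (_ : _ `&` _ = set0) ?measure0 //.
apply/seteqP; split=> z //=; rewrite !in_itv /= andbT.
by move=> [z1 /andP[_]]; rewrite leNgt z1.
Qed.

(** By independence both sides are products over the variables, and only the factor at [i] differs:
    [y - x] instead of 1. *)
Lemma prob_box_itv A i (x y : R) : (forall j, measurable (A j)) -> A i = setT ->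
  0 <= x -> x <= y -> y <= 1 ->
  fine (P (box (fun j => if j == i then `]x, y]%classic else A j)))
  = (y - x) * fine (P (box A)).
Proof.
move=> mA AiT x0 xy y1.
have mA' j : measurable (if j == i then `]x, y]%classic else A j) by case: ifP.
rewrite !prob_box // (bigD1 i) //= eqxx prob_itvoc //.
rewrite [in RHS](bigD1 i) //= AiT preimage_setT probability_setT mul1e.
rewrite (eq_bigr (fun j => P (X j @^-1` A j))); last first.
  by move=> j /negbTE ->.
rewrite fineM //; apply: (big_ind (fun z : \bar R => z \is a fin_num)) => //.
  exact: fin_numM.
move=> j _; apply: fin_num_measure.
rewrite -[X in measurable X]setTI; exact: measurable_funPT.
Qed.

(* Conditioning on [X k] expresses the probability at [k.+1] as a primitive of
   the probability at [k]; its increments over small intervals are enclosed by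
   independence alone, so no product measure is needed. The box on the later
   variables carries their independence through the induction. *)
Lemma prob_spaced_box (c : nat -> R) k t A : (forall j, 0 <= c j) -> (k <= n)%N -> t <= 1 ->
  (forall i, measurable (A i)) -> (forall i : 'I_n, (i < k)%N -> A i = setT) ->
  fine (P (spaced c k t `&` box A)) =
  truncated_power k (\sum_(j < k.+1) c j) t * fine (P (box A)).
Proof.
move=> c0; elim: k t A => [|k IH] t A kn t1 mA AT.
  rewrite big_ord1 /truncated_power expr0 fact0 divr1.
  case: ifPn => ct.
    rewrite mul1r (_ : spaced _ _ _ = setT) ?setTI //.
    by apply/seteqP; split=> w // _; split=> [[]//|/=]; rewrite add0r.
  rewrite mul0r (_ : spaced _ _ _ = set0) ?set0I ?measure0 //.
  by apply/seteqP; split=> w // -[_] /=; rewrite add0r (negbTE ct).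
pose i := Ordinal kn; set S := \sum_(j < k.+1) c j.
have S0 : 0 <= S by apply: sumr_ge0.
have mB := measurable_box mA.
(* Shifting the endpoint by [c k.+1] turns the last condition into [X i <= x], so an increment of
   [F] confines [X i] to a small interval. *)
pose F x := fine (P (spaced c k.+1 (x + c k.+1) `&` box A)).
pose G x := truncated_power k.+1 S x * fine (P (box A)).
have mF x : measurable (spaced c k.+1 (x + c k.+1) `&` box A).
  by apply: measurableI => //; exact: measurable_spaced.
have spacedE x w : spaced c k.+1 (x + c k.+1) w <->
    spaced c k (X i w) w /\ X i w <= x.
  by rewrite (spacedS _ _ _ kn) lerD2r.
have F0 x : x <= 0 -> F x = 0.
  move=> x0; rewrite /F (@subset_measure0 _ _ _ P _ [set w | X i w <= 0]) //.
  - by apply: measurable_set_ler; [exact: measurable_funPT|exact: measurable_cst].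
  - by move=> w [/spacedE[_ /le_trans]] /(_ _ x0).
  - exact: prob_nonpos.
have G0 x : x <= 0 -> G x = 0.
  by move=> x0; rewrite /G truncated_powerS0 ?mul0r // (le_trans x0).
have FG x : x <= 1 -> F x = G x.
  move=> x1; have [x0|/ltW x0] := leP x 0; first by rewrite F0 // G0.
  suff: F x - F 0 = G x - G 0 by rewrite (F0 0) // (G0 0) // !subr0.
  apply: (@primitive_increment_unique _
    (fun z => truncated_power k S z * fine (P (box A)))) => // y z y0 yz zx;
    last first.
    have /andP[h1 h2] := truncated_power_increment k S yz.
    by rewrite /G -mulrBl ![_ * fine _ * _]mulrAC !ler_wpM2r ?fine_ge0.
  have z1 := le_trans zx x1.
  (* The confinement of [X i] to []y, z]] is moved into the box, where the induction hypothesis can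
     handle it because [i] has index [k]. *)
  pose A' j := if j == i then `]y, z]%classic else A j.
  have mA' j : measurable (A' j) by rewrite /A'; case: ifP.
  have AT' (j : 'I_n) : (j < k)%N -> A' j = setT.
    move=> jk; rewrite /A' ifN ?AT //; first exact: ltnW.
    by apply: contraTneq jk => ->; rewrite ltnn.
  have boxA' w : box A' w <-> (y < X i w <= z) /\ box A w.
    split=> [h|[h1 h2] j _].
      split=> [|j _]; first by have := h i Logic.I; rewrite /A' eqxx /= in_itv.
      have := h j Logic.I; rewrite /A' /=; case: eqP => // -> _.
      by rewrite AT //= ltnSn.
    by rewrite /A' /=; case: eqP => [->|_]; [rewrite /= in_itv | exact: h2].
  have mono u v : u <= v -> spaced c k u `<=` spaced c k v.
    by move=> uv w [h1 h2]; split=> //; exact: le_trans uv.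
  have prob u : u <= 1 -> fine (P (spaced c k u `&` box A')) =
      truncated_power k S u * fine (P (box A)) * (z - y).
    move=> u1; rewrite IH // ?(ltnW kn) // prob_box_itv ?AT //=; first by ring.
  have mS u : measurable (spaced c k u `&` box A').
    by apply: measurableI; [exact: measurable_spaced | exact: measurable_box].
  rewrite /F -fine_measureD //; last first.
    move=> w [/spacedE[h1 h2] h3]; split=> //; apply/spacedE; split=> //.
    exact: le_trans yz.
  rewrite -!prob ?(le_trans yz) //.
  (* For [y < X i w <= z], monotonicity places [spaced c k (X i w)] between [spaced c k y] and
     [spaced c k z], whose probabilities with [box A'] are known from [prob]. *)
  apply/andP; split; apply: fine_measure_le => //; try exact: measurableD.
    move=> w [h1 /boxA'[/andP[h2 h3] h4]]; split.
      by split=> //; apply/spacedE; split=> //; apply: mono h1; exact: ltW.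
    by move=> [/spacedE[_]]; rewrite leNgt h2.
  move=> w [[/spacedE[h1 h2] h3] h4]; split; first exact: mono h1.
  apply/boxA'; split=> //; rewrite h2 andbT ltNge; apply/negP => h5.
  by apply: h4; split=> //; apply/spacedE.
have := FG (t - c k.+1); rewrite /F /G subrK => ->; last first.
  by rewrite lerBlDr (le_trans t1) // lerDl.
rewrite big_ord_recr /= -/S /truncated_power lerBrDr.
by rewrite (_ : t - c k.+1 - S = t - (S + c k.+1)) //; ring.
Qed.

Lemma prob_spaced (c : nat -> R) : (forall j, 0 <= c j) ->
  fine (P (spaced c n 1)) = truncated_power n (\sum_(j < n.+1) c j) 1.
Proof.
move=> c0; have := @prob_spaced_box c n 1 (fun=> setT) c0 (leqnn n) (lexx 1).
rewrite (_ : box _ = setT); last by apply/seteqP; split.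
by rewrite setIT probability_setT mulr1 => ->.
Qed.

End Spacings.

(** * Long gaps and their almost disjoint union *)

(** Induction on [r]: [G i] meets the union of the later events in a finite union of null sets, so
    the correction term for the overlap vanishes. *)
Lemma fine_measure_bigsetU_null (d : measure_display) (T : measurableType d)
    (R : realType) (P : probability T R) (I : eqType) (r : seq I)
    (G : I -> set T) :
  (forall i, measurable (G i)) ->
  (forall i j, i != j -> P (G i `&` G j) = 0%E) -> uniq r ->
  fine (P (\big[setU/set0]_(i <- r) G i)) = \sum_(i <- r) fine (P (G i)).
Proof.
move=> mG G0; elim: r => [|i r IH] /=; first by rewrite !big_nil measure0.
move=> /andP[ir ur]; rewrite !big_cons -IH //.
have mU s : measurable (\big[setU/set0]_(j <- s) G j).
  by apply: bigsetU_measurable.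
have null : P (G i `&` \big[setU/set0]_(j <- r) G j) = 0%E.
  elim: r ir {IH ur} => [|j r IH]; first by rewrite big_nil setI0 measure0.
  rewrite inE negb_or => /andP[ij ir]; rewrite big_cons setIUr setUC.
  rewrite -(IH ir); apply: measureU0; [exact: measurableI..|exact: G0].
rewrite measureUfinl ?ltey_eq ?fin_num_measure // [X in (_ - X)%E]null.
by rewrite sube0 fineD ?fin_num_measure.
Qed.

Lemma division_point_ord (R : realType) (n : nat) (x : 'I_n -> R) (i : 'I_n) :
  division_point x i.+1 = x i.
Proof. by rewrite /= valK. Qed.

Lemma division_point_last (R : realType) (n : nat) (x : 'I_n -> R) :
  division_point x n.+1 = 1.
Proof. by rewrite /= insubF // ltnn. Qed.

(** The signed lengths telescope to 1 whatever the order of the points, so a length [l] is compared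
    with [1 - l]. *)
Lemma itv_length_lt_sum_others (R : realType) (n : nat) (x : 'I_n -> R)
    (i : 'I_n.+1) :
  (itv_length (division_itv x i)
     < \sum_(j < n.+1 | j != i) itv_length (division_itv x j))
  = (division_point x i.+1 - division_point x i < 2^-1).
Proof.
rewrite /itv_length /=.
have : \sum_(j < n.+1) (division_point x j.+1 - division_point x j) = 1.
  rewrite -(big_mkord xpredT
    (fun j => division_point x j.+1 - division_point x j)).
  by rewrite telescope_sumr // division_point_last subr0.
rewrite (bigD1 i) //=; set s := \sum_(j < _ | _) _; set l := (X in X + s).
by move=> ls; rewrite -/l; apply/idP/idP; lra.
Qed.

Section Gaps.
Context (R : realType) (d : measure_display) (T : measurableType d).
Context (P : probability T R) (n : nat) (X : 'I_n -> {RV P >-> R}).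

(** At level [n] the endpoint 1 is itself the division point of index [n.+1], so the separate last
    condition becomes one more gap inequality. *)
Lemma spaced_lastE (c : nat -> R) w :
  spaced X c n 1 w <->
  forall j : 'I_n.+1, division_point (X ^~ w) j + c j
                      <= division_point (X ^~ w) j.+1.
Proof.
split=> [[h1 h2] j|h].
  case: (unliftP ord_max j) => [i|] ->; first by rewrite lift_max; exact: h1.
  by rewrite division_point_last.
split=> [j|]; first by have := h (widen_ord (leqnSn n) j).
by have := h ord_max; rewrite division_point_last.
Qed.

Lemma spaced_sorted (c : nat -> R) w (i j : 'I_n) : (forall k, 0 <= c k) ->
  spaced X c n 1 w -> (i <= j)%N -> X i w <= X j w.
Proof.
move=> c0 /spaced_lastE h ij.
have DS k : (k <= n)%N ->
    division_point (X ^~ w) k <= division_point (X ^~ w) k.+1.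
  by move=> kn; apply: le_trans (h (Ordinal (kn : (k < n.+1)%N))); rewrite lerDl.
rewrite -(division_point_ord (X ^~ w) i) -(division_point_ord (X ^~ w) j).
move: (ltn_ord j); rewrite -(subnKC ij); elim: (j - i)%N => [|m IH].
  by rewrite addn0.
rewrite addnS => mn; apply: le_trans (IH (ltnW mn)) _; exact/DS/ltnW.
Qed.

(** As the choice of [c] in [spaced], this describes sorted points whose gap [i] is too long. *)
Definition half_at (i j : nat) : R := if j == i then 2^-1 else 0.

Lemma half_at_ge0 i j : 0 <= half_at i j.
Proof. by rewrite /half_at; case: ifP => //; rewrite invr_ge0. Qed.

Lemma sum_half_at (i : 'I_n.+1) : \sum_(j < n.+1) half_at i j = 2^-1.
Proof.
rewrite (bigD1 i) //= /half_at eqxx big1 ?addr0 // => j ji.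
by rewrite ifN.
Qed.

Lemma gap_event_measurable :
  measurable [set w | (forall i j : 'I_n, (i <= j)%N -> X i w <= X j w) /\
     (forall i : 'I_n.+1, division_point (X ^~ w) i.+1
                          - division_point (X ^~ w) i < 2^-1)].
Proof.
have mX i : measurable_fun setT (X i) by exact: measurable_funPT.
have mD j : measurable_fun setT (fun w => division_point (X ^~ w) j).
  exact: measurable_division_point.
apply: measurableI; apply: measurable_set_forall => i.
  apply: measurable_set_forall => j; case: leqP => ij.
    rewrite [X in measurable X](_ : _ = [set w | X i w <= X j w]).
      exact: measurable_set_ler.
    by apply/seteqP; split=> w /= h; [exact: h | move=> _].
  by rewrite [X in measurable X](_ : _ = setT) //; apply/seteqP; split.
rewrite [X in measurable X](_ : _ = ~` [set w | 2^-1 <= division_point (X ^~ w) i.+1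
                          - division_point (X ^~ w) i]).
  apply/measurableC/measurable_set_ler; first exact: measurable_cst.
  exact: measurable_funB.
by apply/seteqP; split=> w /=; rewrite ltNge => /negP.
Qed.

Context (indepX : mutually_independent X).
Context (unifX : forall i : 'I_n, uniformly_distributed01 (X i)).

(** At distinct indices the two requirements add up to one of total 1, and a truncated power of
    positive exponent vanishes at its threshold. *)
Lemma prob_two_halves (i j : 'I_n.+1) : (0 < n)%N -> i != j ->
  P (spaced X (half_at i) n 1 `&` spaced X (half_at j) n 1) = 0%E.
Proof.
move=> n0 ij; pose c k := half_at i k + half_at j k.
apply: (@subset_measure0 _ _ _ P _ (spaced X c n 1)).
- by apply: measurableI; exact: measurable_spaced.
- exact: measurable_spaced.
- move=> w [/spaced_lastE h1 /spaced_lastE h2]; apply/spaced_lastE => k.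
  have := h1 k; have := h2 k; rewrite /c /half_at.
  case: (nat_of_ord k =P i) => [ki|_]; case: (nat_of_ord k =P j) => [kj|_];
    rewrite ?addr0 ?add0r //.
  by move: ij; rewrite -val_eqE /= -ki -kj eqxx.
rewrite -[LHS]fineK ?fin_num_measure //; last exact: measurable_spaced.
rewrite prob_spaced //; last by move=> k; rewrite addr_ge0 ?half_at_ge0.
rewrite big_split /= !sum_half_at -(prednK n0) truncated_powerS0 //.
by rewrite le_eqVlt; apply/orP; left; apply/eqP; field.
Qed.

Lemma prob_all_gaps_lt_half : (0 < n)%N ->
  fine (P (spaced X (fun=> 0) n 1 `\`
           \big[setU/set0]_(i < n.+1) spaced X (half_at i) n 1))
  = (2 ^+ n - n.+1%:R) / (2 ^+ n * (n`!)%:R).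
Proof.
move=> n0; rewrite fine_measureD; last first.
- move=> w; rewrite -bigcup_seq => -[i _ /spaced_lastE h].
  apply/spaced_lastE => j; apply: le_trans (h j); rewrite lerD2l.
  exact: half_at_ge0.
- by apply: bigsetU_measurable => i _; exact: measurable_spaced.
- exact: measurable_spaced.
rewrite fine_measure_bigsetU_null ?index_enum_uniq //; last 2 first.
- by move=> i; exact: measurable_spaced.
- by move=> i j; exact: prob_two_halves.
rewrite (eq_bigr (fun=> truncated_power n 2^-1 1)); last first.
  by move=> i _; rewrite prob_spaced ?sum_half_at // => j; exact: half_at_ge0.
rewrite prob_spaced // big1 // sumr_const card_ord /truncated_power ler01.
rewrite invf_le1 // ler1n /= subr0 expr1n.
have -> : 1 - 2^-1 = 2^-1 :> R by field.
rewrite exprVn -mulr_natl; field.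
by rewrite expf_neq0 ?pnatr_eq0 //= -lt0n fact_gt0.
Qed.

End Gaps.

(** * Comparison of the stated event with the spacing events *)

Theorem mainTheorem2 (R : realType) (d : measure_display) (T : measurableType d)
    (P : probability T R) (n : nat) (hn : (2 <= n)%N)
    (X : 'I_n -> {RV P >-> R})
    (indepX : mutually_independent X)
    (unifX : forall i : 'I_n, uniformly_distributed01 (X i)) :
  P [set w | (forall i j : 'I_n, (i <= j)%N -> X i w <= X j w) /\
             (forall i : 'I_n.+1,
                itv_length (division_itv (fun k => X k w) i) <
                \sum_(j < n.+1 | j != i)
                   itv_length (division_itv (fun k => X k w) j))]
  = ((2 ^+ n - n.+1%:R) / (2 ^+ n * (n`!)%:R))%:E.
Proof.
have n0 : (0 < n)%N by exact: ltnW.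
pose E := [set w | (forall i j : 'I_n, (i <= j)%N -> X i w <= X j w) /\
  (forall i : 'I_n.+1, division_point (X ^~ w) i.+1
                       - division_point (X ^~ w) i < 2^-1)].
rewrite (_ : [set w | _] = E); last first.
  apply/seteqP; split=> w -[h1 h2]; split=> // i; have := h2 i;
    by rewrite itv_length_lt_sum_others.
have mE : measurable E by exact: gap_event_measurable.
have mSpaced c : measurable (spaced X c n 1) by exact: measurable_spaced.
pose B := spaced X (fun=> 0) n 1 `\`
          \big[setU/set0]_(i < n.+1) spaced X (half_at R i) n 1.
have mB : measurable B.
  by apply: measurableD => //; apply: bigsetU_measurable.
pose fst_ : 'I_n := Ordinal n0.
pose lst_ : 'I_n := Ordinal (etrans (ltn_predL n) n0 : (n.-1 < n)%N).
(* Unlike [B], the event [E] does not force the first point to be nonnegative or the last to be at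
   most 1. The null events [N0] and [N1] cover this difference. *)
pose N0 := [set w | X fst_ w <= 0]; pose N1 := [set w | 1 < X lst_ w].
have mN0 : measurable N0.
  by apply: measurable_set_ler; [exact: measurable_funPT | exact: measurable_cst].
have mN1 : measurable N1.
  rewrite (_ : N1 = ~` [set w | X lst_ w <= 1]).
    apply/measurableC/measurable_set_ler; first exact: measurable_funPT.
    exact: measurable_cst.
  by apply/seteqP; split=> w; rewrite /N1 /= ltNge => /negP.
have BE : B `<=` E.
  move=> w [h1 h2]; split=> [i j|i].
    by apply: (spaced_sorted _ h1).
  (* A gap [i] of length at least 1/2, with all other gaps nonnegative, would put [w] in the removed
     event for [half_at R i]. *)
  rewrite ltNge; apply/negP => h; apply: h2; rewrite -bigcup_seq.
  exists i; first by rewrite /= mem_index_enum.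
  move/spaced_lastE: h1 => h1; apply/spaced_lastE => j; have := h1 j.
  by rewrite /half_at; case: eqP => // /val_inj ->; lra.
have EB : E `<=` B `|` N0 `|` N1.
  move=> w [h1 h2]; case: (leP (X fst_ w) 0) => [|w0]; first by left; right.
  case: (ltP 1 (X lst_ w)) => [|w1]; first by right.
  left; left; split; last first.
    rewrite -bigcup_seq => -[i _ /spaced_lastE /(_ i)].
    by have := h2 i; rewrite /half_at eqxx; lra.
  (* The first gap is nonnegative since [w] is outside [N0], the inner ones by sortedness, the last
     since [w] is outside [N1]. *)
  split=> [[[|j] jn]|]; rewrite addr0.
  - by rewrite (division_point_ord (X ^~ w) fst_) ltW.
  - rewrite (division_point_ord (X ^~ w) (Ordinal (ltnW jn))).
    rewrite (division_point_ord (X ^~ w) (Ordinal jn)).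
    exact: h1.
  - by have := division_point_ord (X ^~ w) lst_; rewrite prednK // => ->.
have PE : P E = P B.
  apply/eqP; rewrite eq_le; apply/andP; split; last by rewrite le_measure ?inE.
  have mBN : measurable (B `|` N0) by exact: measurableU.
  apply: (@le_trans _ _ (P (B `|` N0 `|` N1))).
    by rewrite le_measure ?inE //; exact: measurableU.
  rewrite (@measureU0 _ _ _ P _ _ mBN mN1); last exact: prob_gt1.
  by rewrite (@measureU0 _ _ _ P _ _ mB mN0) //; exact: prob_nonpos.
by rewrite PE -[LHS]fineK ?fin_num_measure // prob_all_gaps_lt_half.
Qed.
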